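(* Let $h$ and $t$ be integers with $2 \leq t \leq \log h / \log 2$. Then there exists a partition $\mathbb{N} = W_0 \cup W_1 \cup \dots \cup W_{h-1}$ of $\mathbb{N}$ into pairwise disjoint sets such that each set $W_i$ ($0 \le i \le h-1$) is a union of infinitely many intervals, each consisting of at least $t$ consecutive integers, and such that $$A = A(W_0) \cup A(W_1) \cup \dots \cup A(W_{h-1})$$ is not a minimal asymptotic basis of order $h$.
   Context: $\mathbb{N}$ denotes the set of all nonnegative integers. For a nonempty subset $W \subseteq \mathbb{N}$, $A(W)$ denotes the set of all integers of the form $\sum_{f \in F} 2^f$, where $F$ ranges over all finite nonempty subsets of $W$. For $h \ge 2$, a set $A \subseteq \mathbb{N}$ is an asymptotic basis of order $h$ if every sufficiently large integer $n$ can be written as $n = a_1 + \dots + a_h$ with $a_1, \dots, a_h \in A$ (not necessarily distinct). An asymptotic basis $A$ of order $h$ is minimal if no proper subset of $A$ is an asymptotic basis of order $h$. *)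

(* Defs.v *)
From mathcomp Require Import all_boot finmap.
From mathcomp Require Import classical_sets cardinality.

Set Implicit Arguments.
Unset Strict Implicit.
Unset Printing Implicit Defensive.

Local Open Scope classical_set_scope.
Local Open Scope nat_scope.

Definition binary_sums (W : set nat) : set nat :=
  [set n | exists F : {fset nat},
     [/\ F != fset0, {in F, forall f, W f} & n = \sum_(f <- F) 2 ^ f]].

Definition asymptotic_basis (h : nat) (A : set nat) : Prop :=
  exists n0 : nat, forall n : nat, n0 <= n ->
    exists2 a : 'I_h -> nat, forall i, A (a i) & n = \sum_(i < h) a i.

Definition minimal_asymptotic_basis (h : nat) (A : set nat) : Prop :=
  asymptotic_basis h A /\
  ~ exists2 B : set nat, B `<` A & asymptotic_basis h B.

Definition interval_of_length_ge (t : nat) (J : set nat) : Prop :=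
  exists a l : nat, t <= l /\ J = [set n | a <= n < a + l].

(* The intervals are required to be pairwise disjoint, but adjacent ones are
   allowed, so the members of [F] need not be the maximal runs of [W]. *)
Definition union_of_intervals_ge (t : nat) (W : set nat) : Prop :=
  exists F : set (set nat),
    [/\ infinite_set F,
        forall J, F J -> interval_of_length_ge t J,
        trivIset F id
      & W = \bigcup_(J in F) J].

(* Main.v *)
(** Cut [N] into blocks of length [t]; give every even block to [W_0] and deal
    the odd blocks out cyclically to [W_0, ..., W_(h-1)]. Then [A] minus the
    single element [2] is still a basis of order [h]. Write [n_i] for the part of
    the binary expansion of [n] in [W_i]. If [n_0 <> 2], the nonzero [n_i] are at
    most [h] admissible summands. If [n_0 = 2], the rest [m = n - 2] only uses odd
    blocks, each preceded by a block of [W_0], and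
    [2^(q t + b) = 2^b * (2^t - 1) 2^((q-1) t) + 2^((q-1) t + b)] rewrites [m]
    with [2^t - 1 <= h - 1] summands in [A(W_0)] plus [m / 2^t], which is again
    in [A(W_0)] and absorbs the leftover [2]. Finally a summand that is at least
    [8] always splits into two admissible ones, so the number of summands can be
    raised to [h]. *)
Require Import Defs.
From mathcomp Require Import all_boot finmap.
From mathcomp Require Import classical_sets cardinality.
From Stdlib Require Import Reals.
(* [Reals] rebinds [^] to [Nat.pow]; importing [ssrnat] last restores [expn]. *)
From mathcomp Require Import ssrnat zify.
From Stdlib Require Import Lra.

Local Open Scope classical_set_scope.
Local Open Scope nat_scope.

(** * Sums of distinct powers of two *)

Lemma sum_pow2 (n : nat) : \sum_(i < n) 2 ^ i = 2 ^ n - 1.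
Proof.
elim: n => [|n IH]; first by rewrite big_ord0.
by rewrite big_ord_recr /= IH expnS; have := expn_gt0 2 n; lia.
Qed.

(** Bit [f + 1] of [n] is bit [f] of its half, so induction on the length works. *)
Lemma binary_expansion (n N : nat) :
  n < 2 ^ N -> n = \sum_(f < N | odd (n %/ 2 ^ f)) 2 ^ f.
Proof.
elim: N n => [|N IH] n.
  by rewrite expn0 big_ord0; case: n.
move=> lt_n; rewrite big_mkcond big_ord_recl /= expn0 divn1.
have lt_half : n./2 < 2 ^ N by rewrite -divn2 ltn_divLR // mulnC -expnS.
rewrite -{1}(odd_double_half n) {1}(IH _ lt_half) -mul2n big_distrr /=.
congr (_ + _).
rewrite big_mkcond; apply: eq_bigr => i _.
by rewrite /bump /= add1n expnS -divn2 divnMA.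
Qed.

Lemma sum_blocks (t Q : nat) (F : nat -> nat) :
  \sum_(f < Q * t) F f = \sum_(q < Q) \sum_(r < t) F (q * t + r).
Proof.
elim: Q => [|Q IH]; first by rewrite mul0n !big_ord0.
by rewrite big_ord_recr /= -IH mulSn addnC big_split_ord.
Qed.

(** Bridges bounded sums and finite sets; a nonzero value guarantees the nonempty exponent set that
    [binary_sums] asks for. *)
Lemma binary_sumsP (W : set nat) (N : nat) (p : pred nat) :
    (forall f, f < N -> p f -> W f) ->
    \sum_(f < N | p f) 2 ^ f != 0 ->
  binary_sums W (\sum_(f < N | p f) 2 ^ f).
Proof.
move=> pW nz.
pose F := [fset f in iota 0 N | p f]%fset.
have inF f : f \in F = (f < N) && p f by rewrite !inE mem_iota.
have sumF : \sum_(f < N | p f) 2 ^ f = \sum_(f <- F) 2 ^ f.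
  rewrite -(big_mkord p (fun f => 2 ^ f)) -big_filter; apply: perm_big.
  apply: uniq_perm; rewrite ?filter_uniq ?iota_uniq ?fset_uniq // => f.
  by rewrite inF mem_filter mem_index_iota andbC.
exists F; split=> //; last by move=> f; rewrite inF => /andP[]; exact: pW.
by apply: contraNneq nz => F0; rewrite sumF F0 big_seq_fset0.
Qed.

Lemma binary_sums_pow2 (W : set nat) (f : nat) : W f -> binary_sums W (2 ^ f).
Proof.
move=> Wf; exists [fset f]%fset; split.
- by apply/fset0Pn; exists f; rewrite inE.
- by move=> g; rewrite inE => /eqP ->.
- by rewrite big_seq_fset1.
Qed.

Lemma fset_sum_lt (F : {fset nat}) (k : nat) :
  {in F, forall f, f < k} -> \sum_(f <- F) 2 ^ f < 2 ^ k.
Proof.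
move=> Fk.
have le : \sum_(f <- F) 2 ^ f <= \sum_(i < k) 2 ^ i.
  have perm : perm_eq F [seq f <- index_iota 0 k | f \in F].
    apply: uniq_perm; rewrite ?filter_uniq ?iota_uniq ?fset_uniq // => f.
    by rewrite mem_filter mem_index_iota; case: (boolP (f \in F)) => // /Fk ->.
  rewrite (perm_big _ perm) big_filter -(big_mkord xpredT (fun i => 2 ^ i)).
  by rewrite big_mkcond; apply: leq_sum => i _; case: ifP.
by move: le; rewrite sum_pow2; have := expn_gt0 2 k; lia.
Qed.

(** * The partition into blocks of length [t] *)

Definition block_class (h t f : nat) : nat :=
  if odd (f %/ t) then (f %/ t)./2 %% h else 0.

Definition block_partition (h t : nat) (i : 'I_h) : set nat :=
  [set f | block_class h t f = i].

Lemma block_class_lt (h t f : nat) : 0 < h -> block_class h t f < h.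
Proof. by move=> h0; rewrite /block_class; case: ifP => // _; rewrite ltn_mod. Qed.

(** The intervals are the single blocks [J q]; consecutive blocks of the same class are not
    merged. *)
Lemma block_partition_intervals (h t : nat) (i : 'I_h) :
  0 < t -> union_of_intervals_ge t (block_partition h t i).
Proof.
move=> t0.
have h0 : 0 < h by case: i => m; lia.
pose J q : set nat := [set n | q * t <= n < q * t + t].
have Jdiv q n : J q n <-> n %/ t = q.
  rewrite /J /=; split=> [/andP[le lt]|<-].
    apply/eqP; rewrite eqn_leq leq_divRL // le andbT.
    by rewrite -ltnS ltn_divLR // mulSn addnC.
  by rewrite leq_divM /= {1}(divn_eq n t) ltn_add2l ltn_mod.
have clsJ q n : J q n -> block_class h t n = block_class h t (q * t).
  by move=> /Jdiv nq; rewrite /block_class nq mulnK.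
have Jq q : J q (q * t) by apply/Jdiv; rewrite mulnK.
exists [set J q | q in [set q | block_class h t (q * t) = i]]; split.
- have injJ : injective J.
    by move=> q q' eqJ; have := Jq q; rewrite eqJ => /Jdiv; rewrite mulnK.
  (* The block number is odd, and its half, rounded down, is [i] modulo [h]; so class [i] receives
     infinitely many blocks. *)
  pose g k := J (2 * (h * k + i)).+1.
  have gi : injective g.
    move=> k k' /injJ eqkk'; apply/eqP; rewrite -(eqn_pmul2l h0); apply/eqP; lia.
  apply: (@sub_infinite_set _ (range g)).
    move=> _ [k _ <-]; exists (2 * (h * k + i)).+1 => //=.
    rewrite /block_class mulnK // /= mul2n odd_double /= uphalf_double.
    by rewrite mulnC modnMDl modn_small.
  by rewrite (eq_finite_set (inj_card_eq (in2W gi))); exact: infinite_nat.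
- by move=> _ [q _ <-]; exists (q * t), t.
- by move=> _ _ [q _ <-] [q' _ <-] [n [/Jdiv <- /Jdiv <-]].
- apply/seteqP; split=> [n ni|n [_ [q qi <-] Jn]] /=.
    exists (J (n %/ t)); last exact/Jdiv.
    by exists (n %/ t) => //=; rewrite -ni; apply/esym/clsJ/Jdiv.
  by rewrite /block_partition /= (clsJ _ _ Jn).
Qed.

(** * Removing 2, and raising the number of summands *)

Definition block_basis (h t : nat) : set nat :=
  \bigcup_(i : 'I_h) binary_sums (block_partition h t i).

Definition punctured_basis (h t : nat) : set nat := block_basis h t `\ 2.

Lemma block_class_small (h t f : nat) : f < t -> block_class h t f = 0.
Proof. by move=> ft; rewrite /block_class divn_small. Qed.

Lemma block_basis_pow2 (h t f : nat) : 0 < h -> block_basis h t (2 ^ f).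
Proof.
move=> h0; exists (Ordinal (block_class_lt h t f h0)) => //.
exact: binary_sums_pow2.
Qed.

Lemma punctured_basis_pow2 (h t f : nat) :
  0 < h -> f != 1 -> punctured_basis h t (2 ^ f).
Proof.
move=> h0 f1; split; first exact: block_basis_pow2.
by move=> /= /eqP; rewrite (eqn_exp2l f 1 (ltnSn 1)) (negbTE f1).
Qed.

(** Some exponent [f >= 3] occurs in [x], and [2 ^ f] is split off. The rest is admissible unless it
    is 0 or 2; if it is 0, [2 ^ f] is halved instead. *)
Lemma punctured_basis_split (h t x : nat) :
    0 < h -> 2 <= t -> punctured_basis h t x -> 8 <= x ->
  exists y z, [/\ punctured_basis h t y, punctured_basis h t z & x = y + z].
Proof.
move=> h0 t2 [[i _ [F [F0 FW ->]]] _] ge8.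
have [f fF f3] : exists2 f, f \in F & 3 <= f.
  have [/hasP[f fF f3]|/hasPn small] := boolP (has (fun f => 3 <= f) F).
    by exists f.
  suff : \sum_(f <- F) 2 ^ f < 2 ^ 3 by move: ge8; lia.
  by apply: fset_sum_lt => f /small; lia.
rewrite (big_fsetD1 f fF) /=; set R := \sum_(g <- _) _.
have pf : punctured_basis h t (2 ^ f) by apply: punctured_basis_pow2; lia.
case: (eqVneq R 0) => [->|R0].
  exists (2 ^ f.-1), (2 ^ f.-1); split; try by apply: punctured_basis_pow2; lia.
  by rewrite addn0 addnn -mul2n -expnS prednK //; lia.
have D0 : (F `\ f != fset0)%fset.
  by apply: contraNneq R0 => D0; rewrite /R D0 big_seq_fset0.
case: (eqVneq R 2) => [R2|neR2]; last first.
  exists (2 ^ f), R; split=> //; split; last exact/eqP.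
  exists i => //; exists (F `\ f)%fset; split=> // g.
  by rewrite !inE => /andP[_ gF]; exact: FW.
(* A rest of 2 uses an exponent below 2. This lies in the first block, so [x] comes from class 0,
   where exponent 0 is available too. *)
have i0 : i = 0 :> nat.
  have /fset0Pn[g gD] := D0.
  have g1 : g < 2.
    have : 2 ^ g <= 2.
      move: R2; rewrite /R (big_fsetD1 g gD) /= => eq2.
      by rewrite -[leqRHS]eq2 leq_addr.
    by rewrite -[leqRHS]/(2 ^ 1) leq_exp2l.
  have gF : g \in F by move: gD; rewrite !inE => /andP[].
  by rewrite -(FW _ gF) block_class_small //; lia.
(* [2^f + 2] is split as [(2^f + 1) + 1] to avoid the removed [2]. *)
exists (2 ^ f + 2 ^ 0), (2 ^ 0); split; last by rewrite R2; lia.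
  have f2 : 2 ^ 3 <= 2 ^ f by rewrite leq_exp2l.
  split; last by move=> /=; move: f2; lia.
  exists i => //; exists [fset f; 0]%fset; split.
  - by apply/fset0Pn; exists f; rewrite !inE eqxx.
  - move=> g; rewrite !inE => /orP[/eqP->|/eqP->]; first exact: FW.
    by rewrite /block_partition /= block_class_small //; lia.
  - by rewrite big_fsetU1 ?big_seq_fset1 // inE; lia.
by apply: punctured_basis_pow2.
Qed.

(** At most [h] summands with total at least [8 * h] include one that is at least 8 and can be
    split; the induction is on the number still missing. *)
Lemma punctured_basis_pad (h t n : nat) (s : seq nat) :
    0 < h -> 2 <= t -> size s <= h -> 8 * h <= n ->
    {in s, forall x, punctured_basis h t x} -> n = sumn s ->
  exists2 a : 'I_h -> nat, forall i, punctured_basis h t (a i) &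
    n = \sum_(i < h) a i.
Proof.
move=> h0 t2 le_s le_n sB sn.
move: {2}(h - size s) (erefl (h - size s)) => d.
elim: d s le_s sB sn => [|d IH] s le_s sB sn szd.
  have sz : size s = h by lia.
  exists (fun i : 'I_h => nth 0 s i).
    by move=> i; apply: sB; apply: mem_nth; rewrite sz.
  by rewrite sn sumnE (big_nth 0) sz big_mkord.
have [/hasP[x xs x8]|/hasPn small] := boolP (has (fun x => 8 <= x) s).
  have [y [z [By Bz xyz]]] := punctured_basis_split _ _ _ h0 t2 (sB _ xs) x8.
  have perm := perm_to_rem xs.
  have szr := size_rem xs.
  have s0 : 0 < size s by case: (s) xs.
  apply: (IH (y :: z :: rem x s)) => /=; rewrite ?szr ?prednK //.
    - by rewrite -subn_gt0 szd.
    - by move=> u; rewrite !inE => /or3P[/eqP->|/eqP->|/mem_rem /sB].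
    - by rewrite sn (perm_sumn perm) /= xyz addnA.
    - by rewrite subnS szd.
have le7 : sumn s <= 7 * size s.
  elim: (s) small => //= x r IHr sm.
  have le_x := sm x (mem_head _ _).
  have /IHr le_r : {in r, forall u, ~~ (8 <= u)}.
    by move=> u ur; apply: sm; rewrite inE ur orbT.
  by lia.
by move: le7; nia.
Qed.

(** 0 is not an admissible summand, so empty parts of an expansion are dropped before padding. *)
Lemma punctured_basis_pad0 (h t n : nat) (s : seq nat) :
    0 < h -> 2 <= t -> size s <= h -> 8 * h <= n ->
    {in s, forall x, x != 0 -> punctured_basis h t x} -> n = sumn s ->
  exists2 a : 'I_h -> nat, forall i, punctured_basis h t (a i) &
    n = \sum_(i < h) a i.
Proof.
move=> h0 t2 le_s le_n sB sn.
apply: (@punctured_basis_pad h t n [seq x <- s | x != 0]) => //.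
- by rewrite size_filter; exact: leq_trans (count_size _ _) le_s.
- by move=> x; rewrite mem_filter => /andP[x0 xs]; exact: sB.
- by rewrite sn; elim: (s) => //= x r ->; case: eqP => [->|].
Qed.

(** * Moving the nonzero classes into class 0 *)

(** Nonzero classes occur only in odd blocks, and the block before an odd one is even. *)
Lemma block_shift_class (h t f b : nat) :
  b < t -> block_class h t ((f %/ t).+1 * t + b) != 0 -> block_class h t f = 0.
Proof.
move=> bt; rewrite {1}/block_class divnMDl ?(divn_small bt) ?addn0 /=; last by lia.
by rewrite /block_class; case: (odd _).
Qed.

Lemma absorb_into_zero_class (h t Q : nat) (p : pred nat) :
    0 < h -> 2 <= t ->
    (forall f, p f -> block_class h t f != 0) ->
    \sum_(f < Q.+1 * t | p f) 2 ^ f != 0 ->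
  exists s : seq nat,
    [/\ size s = 2 ^ t, {in s, forall x, x != 0 -> punctured_basis h t x}
      & 2 + \sum_(f < Q.+1 * t | p f) 2 ^ f = sumn s].
Proof.
move=> h0 t2 pcls; set m := \sum_(f < _ | _) _ => m0.
have t0 : 0 < t by lia.
pose e q b := p (q.+1 * t + b).
have e_cls f b : b < t -> e (f %/ t) b -> block_class h t f = 0.
  by move=> bt /pcls; exact: block_shift_class.
(* Block 1 has class 0 as well, so [p] has no exponent there and block 0 is never filled. This keeps
   exponent 1 free. *)
have e_ge f b : b < t -> e (f %/ t) b -> 2 <= f.
  move=> bt; rewrite leqNgt => epb; apply/negP => f2.
  have /pcls : p (1 * t + b) by move: epb; rewrite /e divn_small //; lia.
  by rewrite /block_class divnMDl // divn_small //= mod0n.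
(* In [y b] block [q] is full exactly when bit [b] of block [q + 1] is set in [p];
   [y b] will be used [2^b] times. *)
pose y b := \sum_(f < Q * t | e (f %/ t) b) 2 ^ f.
(* [w] is [m] with every exponent lowered by one block. *)
pose w := \sum_(f < Q * t | e (f %/ t) (f %% t)) 2 ^ f.
have mE : m = \sum_(q < Q) \sum_(b < t) e q b * 2 ^ (q.+1 * t + b).
  rewrite /m big_mkcond (sum_blocks t Q.+1 (fun f => if p f then 2 ^ f else 0)).
  rewrite big_ord_recl /= big1 => [|b _]; last first.
    rewrite mul0n add0n; case: ifP => // /pcls.
    by rewrite block_class_small.
  apply: eq_bigr => q _; apply: eq_bigr => b _.
  by rewrite /e /bump add1n; case: (p _); rewrite ?mul1n ?mul0n.
have yE b : y b = \sum_(q < Q) e q b * 2 ^ (q * t) * (2 ^ t - 1).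
  rewrite /y big_mkcond.
  rewrite (sum_blocks t Q (fun f => if e (f %/ t) b then 2 ^ f else 0)).
  apply: eq_bigr => q _; rewrite -sum_pow2 big_distrr; apply: eq_bigr => r _ /=.
  rewrite divnMDl // divn_small // addn0 -mulnA -expnD.
  by case: (e _ _); rewrite ?mul1n ?mul0n.
have wE : w = \sum_(q < Q) \sum_(b < t) e q b * 2 ^ (q * t + b).
  rewrite /w big_mkcond.
  rewrite (sum_blocks t Q (fun f => if e (f %/ t) (f %% t) then 2 ^ f else 0)).
  apply: eq_bigr => q _; apply: eq_bigr => r _.
  rewrite divnMDl // divn_small // addn0 modnMDl modn_small //.
  by case: (e _ _); rewrite ?mul1n ?mul0n.
have total : m = \sum_(b < t) y b * 2 ^ b + w.
  under eq_bigr => b _ do rewrite yE big_distrl.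
  rewrite mE wE [X in _ = X + _]exchange_big -big_split; apply: eq_bigr => q _.
  rewrite -big_split; apply: eq_bigr => b _ /=.
  rewrite mulSn -addnA !expnD; have := expn_gt0 2 t; case: (e _ _) => /=; nia.
have m_w : m = 2 ^ t * w.
  rewrite mE wE big_distrr; apply: eq_bigr => q _.
  rewrite big_distrr; apply: eq_bigr => b _ /=.
  by rewrite mulSn -addnA expnD mulnCA.
have w0 : w != 0 by move: m0; rewrite m_w muln_eq0 negb_or => /andP[].
(* [w != 0] forces [Q > 0], which brings exponent 1 into range. *)
have Qt : 1 < Q * t.
  have Q0 : 0 < Q by move: w0; rewrite wE; case: (Q) => //; rewrite big_ord0.
  by nia.
(* Bit 1 of [w] is free by [e_ge], so adding 2 causes no carry. *)
have w2E : 2 + w =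
    \sum_(f < Q * t | (f == 1 :> nat) || e (f %/ t) (f %% t)) 2 ^ f.
  rewrite (bigD1 (Ordinal Qt)) //=; congr (_ + _); apply: eq_bigl => f.
  rewrite -val_eqE /=; case: eqP => [f1|_] /=; last by rewrite andbT.
  by apply/negP => /(e_ge _ _ (ltn_pmod _ t0)); rewrite f1.
pose i0 : 'I_h := Ordinal h0.
have By b : b < t -> y b != 0 -> punctured_basis h t (y b).
  move=> bt yb0; split.
    exists i0 => //; apply: (@binary_sumsP _ _ (fun f => e (f %/ t) b)) => //.
    by move=> f _; exact: e_cls.
  (* All exponents are at least 2, and a multiple of 4 differs from 2. *)
  have : 4 %| y b.
    by apply: dvdn_sum => f /(e_ge _ _ bt); exact: (@dvdn_exp2l 2 2).
  by move=> + /= => /[swap] ->.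
have Bw : punctured_basis h t (2 + w).
  split; last by move=> /=; move: w0; lia.
  exists i0 => //; rewrite w2E.
  apply: (@binary_sumsP _ _ (fun f => (f == 1) || e (f %/ t) (f %% t))).
    move=> f _ /orP[/eqP->|]; first exact: block_class_small.
    by apply: e_cls; rewrite ltn_mod.
  by rewrite -w2E.
(* The copies number [2 ^ 0 + ... + 2 ^ (t - 1) = 2 ^ t - 1]; the last summand makes [2 ^ t]. *)
exists (flatten [seq nseq (2 ^ b) (y b) | b <- index_iota 0 t] ++ [:: 2 + w]); split.
- rewrite size_cat size_flatten /shape -map_comp sumnE big_map /=.
  rewrite (eq_bigr (fun b => 2 ^ b)) => [|b _]; last by rewrite /= size_nseq.
  by rewrite big_mkord sum_pow2 subnK // expn_gt0.
- move=> x; rewrite mem_cat inE => /orP[|/eqP-> //].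
  case/flatten_mapP => b; rewrite mem_index_iota => /= bt.
  by rewrite mem_nseq => /andP[_ /eqP->]; exact: By.
- rewrite sumn_cat sumn_flatten -map_comp [sumn (map _ _)]sumnE big_map.
  rewrite (eq_bigr (fun b => y b * 2 ^ b)) => [|b _]; last exact: sumn_nseq.
  rewrite big_mkord total /=; lia.
Qed.

(** * The logarithmic bound on [t] *)

Lemma exp2_le_of_log (h t : nat) :
  2 <= t -> (INR t <= ln (INR h) / ln 2)%R -> 2 ^ t <= h.
Proof.
move=> t2 le.
have ln2 : (0 < ln 2)%R by have := ln_lt_2; lra.
have t0 : (0 < INR t)%R by apply: lt_0_INR; lia.
have h0 : (0 < INR h)%R.
  apply: Rnot_le_lt => hle; move: le.
  (* [ln] is [0] at nonpositive arguments. *)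
  have -> : ln (INR h) = 0%R.
    by rewrite /ln; case: Rlt_dec => [pos|_] //; exfalso; lra.
  by rewrite /Rdiv Rmult_0_l; lra.
have le' : (INR t * ln 2 <= ln (INR h))%R.
  have := Rmult_le_compat_r _ _ _ (Rlt_le _ _ ln2) le.
  by rewrite /Rdiv Rmult_assoc Rinv_l ?Rmult_1_r //; lra.
(* [pow_INR] speaks of [Nat.pow], whereas [^] here is [expn]. *)
apply/leP/INR_le; rewrite (_ : 2 ^ t = Nat.pow 2 t); last first.
  by elim: (t) => //= k IH; rewrite expnS IH; lia.
rewrite pow_INR; apply: Rnot_lt_le => lt.
have := ln_increasing _ _ h0 lt; rewrite ln_pow; last by rewrite /=; lra.
by rewrite /= (_ : (1 + 1 = 2)%R) //; lra.
Qed.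

(** * Representing large integers, and the conclusion *)

Lemma punctured_basis_asymptotic (h t : nat) :
  2 <= t -> 2 ^ t <= h -> asymptotic_basis h (punctured_basis h t).
Proof.
move=> t2 le_h.
have h0 : 0 < h by apply: leq_trans le_h; rewrite expn_gt0.
exists (8 * h) => n n_ge.
(* A whole number of blocks, as the absorption step requires, and long enough because
   [n < 2 ^ n]. *)
pose N := n.+1 * t; pose bit f := odd (n %/ 2 ^ f).
have nE : n = \sum_(f < N | bit f) 2 ^ f.
  apply: binary_expansion; apply: leq_trans (ltn_expl n (ltnSn 1)) _.
  by rewrite leq_exp2l // /N; nia.
pose c i := \sum_(f < N | bit f && (block_class h t f == i)) 2 ^ f.
have [c02|c0n2] := eqVneq (c 0) 2.
  pose p f := bit f && (block_class h t f != 0).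
  have nE2 : n = 2 + \sum_(f < N | p f) 2 ^ f.
    by rewrite {1}nE (bigID (fun f : 'I_N => block_class h t f == 0)) /= -/(c 0) c02.
  have [||s [szs sB sumE]] := @absorb_into_zero_class h t n p h0 t2.
  - by move=> f /andP[].
  (* [n >= 8] leaves a nonzero rest once 2 is taken away. *)
  - by rewrite -/N; move: n_ge nE2; set S := \sum_(f < N | _) _; lia.
  by apply: (@punctured_basis_pad0 h t n s) => //; rewrite ?szs // -sumE -nE2.
apply: (@punctured_basis_pad0 h t n [seq c (val i) | i <- enum 'I_h]) => //.
- by rewrite size_map size_enum_ord.
- move=> x /mapP[i _ ->] ci0; split.
    exists i => //.
    apply: (@binary_sumsP _ _ (fun f => bit f && (block_class h t f == i))) => //.
    by move=> f _ /andP[_ /eqP].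
  case: (eqVneq (val i) 0) => [->|i0]; first exact/eqP.
  (* Exponents 0 and 1 lie in block 0, of class 0, so the part of any other class is a multiple of 4
     and cannot be 2. *)
  have : 4 %| c (val i).
    apply: dvdn_sum => f /andP[_ /eqP cls_f]; apply: (@dvdn_exp2l 2 2).
    rewrite leqNgt; apply: contraNN i0 => f2.
    by rewrite -cls_f block_class_small //; lia.
  by move=> + /= => /[swap] ->.
- rewrite sumnE big_map big_enum /= {1}nE.
  rewrite (partition_big (fun f : 'I_N => Ordinal (block_class_lt h t f h0)) xpredT) //.
Qed.

Theorem theorem1 (h t : nat) (t_ge2 : 2 <= t)
    (t_le : (INR t <= ln (INR h) / ln 2)%R) :
  exists W : 'I_h -> set nat,
    [/\ trivIset [set: 'I_h] W,
        \bigcup_(i : 'I_h) W i = [set: nat],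
        forall i : 'I_h, union_of_intervals_ge t (W i)
      & ~ minimal_asymptotic_basis h (\bigcup_(i : 'I_h) binary_sums (W i))].
Proof.
have le_h := exp2_le_of_log _ _ t_ge2 t_le.
have h0 : 0 < h by apply: leq_trans le_h; rewrite expn_gt0.
exists (block_partition h t); split.
- move=> i j _ _ [f [fi fj]]; apply: val_inj.
  by rewrite /= -fi -fj.
- apply/seteqP; split=> // f _.
  by exists (Ordinal (block_class_lt h t f h0)).
- by move=> i; apply: block_partition_intervals; lia.
- case=> _; apply; exists (punctured_basis h t).
    split; first by move=> x [].
    by move=> /(_ 2 (block_basis_pow2 h t 1 h0)) [_]; apply.
  exact: punctured_basis_asymptotic.
Qed.
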